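(* Let $h\ge 2$ be an integer, $b$ a rational number, and $w$ a function assigning a nonnegative rational weight $w_H$ to each graph $H$ on $h$ vertices. Let $\Pi_{h,w,b}$ be the property of all graphs $G$ satisfying $\sum_H w_H\cdot p(H,G)\le b$ (sum over all $h$-vertex graphs $H$). If $\Pi_{h,w,b}$ has a size-oblivious proximity oblivious tester, then $(h,w,b)$ has the removal property.
   Context: $p(H,G)$ is the fraction of induced subgraphs of $G$ on $|V(H)|$ vertices that are isomorphic to $H$. In the dense graph model, an $n$-vertex graph $G$ is $\varepsilon$-far from a property $\Pi$ if at least $\varepsilon n^2$ entries of its adjacency matrix must be changed to obtain a graph in $\Pi$. A proximity oblivious tester (POT) for a graph property $\Pi$ is an algorithm with oracle access to the adjacency matrix which makes a constant number of queries (independent of $n$ and $\varepsilon$) and such that there exist a constant $c\in(0,1]$ and a function $f:(0,1]\to(0,1]$ with: if the input satisfies $\Pi$ it accepts with probability at least $c$, and if the input is $\varepsilon$-far from $\Pi$ it accepts with probability at most $c-f(\varepsilon)$. A tester is size-oblivious if its operation does not depend on the number $n$ of vertices of the input. The tuple $(h,w,b)$ has the removal property if there is a function $f:(0,1]\to(0,1]$ such that for every $\varepsilon\in(0,1)$ and every graph $G$ that is $\varepsilon$-far from $\Pi_{h,w,b}$, one has $\sum_H w_H\cdot p(H,G)\ge b+f(\varepsilon)$. *)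

(* Defs.v *)
From HB Require Import structures.
From mathcomp Require Import all_boot all_order all_algebra.
From mathcomp Require Import reals.
Set Implicit Arguments. Unset Strict Implicit. Unset Printing Implicit Defensive.
Import Order.TTheory GRing.Theory Num.Theory.
Local Open Scope ring_scope.

Definition adjmat (n : nat) := {set 'I_n * 'I_n}.

Definition simple_graph (n : nat) (G : adjmat n) : bool :=
  [forall u : 'I_n, forall v : 'I_n,
     ((u, v) \in G) == ((v, u) \in G)] &&
  [forall u : 'I_n, (u, u) \notin G].

Definition induced_iso (h n : nat) (H : adjmat h) (G : adjmat n)
    (S : {set 'I_n}) : bool :=
  [exists f : {ffun 'I_h -> 'I_n},
     [&& injectiveb f, f @: [set: 'I_h] == S &
         [forall i : 'I_h, forall j : 'I_h,
            ((i, j) \in H) == ((f i, f j) \in G)]]].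

Definition dens (R : realType) (h n : nat) (H : adjmat h) (G : adjmat n) : R :=
  (#|[set S : {set 'I_n} | (#|S| == h) && induced_iso H G S]|%:R)
  / ('C(n, h)%:R).

Definition graph_property := forall n : nat, adjmat n -> Prop.

Definition weighted_sum (R : realType) (h : nat) (w : adjmat h -> rat)
    (n : nat) (G : adjmat n) : R :=
  \sum_(H : adjmat h | simple_graph H) ratr (w H) * dens R H G.

Definition Pi_hwb (R : realType) (h : nat) (w : adjmat h -> rat) (b : rat)
    : graph_property :=
  fun n G => weighted_sum R w G <= ratr b.

Definition mat_dist (n : nat) (G G' : adjmat n) : nat :=
  #|(G :\: G') :|: (G' :\: G)|.

Definition eps_far (R : realType) (P : graph_property) (eps : R)
    (n : nat) (G : adjmat n) : Prop :=
  forall G' : adjmat n, simple_graph G' -> P n G' ->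
    eps * (n%:R ^+ 2) <= (mat_dist G G')%:R.

(* A (randomized, adaptive) oracle algorithm that does not know n, given as
   a finite decision tree.  It can
   - Sample: draw a uniformly random vertex of the input graph (appended to
     the list of vertices drawn so far),
   - Eqv i j: compare the i-th and j-th drawn vertices for equality (free),
   - Query i j: query the adjacency-matrix entry of the i-th and j-th drawn
     vertices (one oracle query),
   - Coin p: flip a coin with bias p,
   - Leaf a: halt, accepting iff a.
   Finiteness of the tree makes the number of queries a constant
   (independent of n and eps); the fact that one and the same tree is run
   on graphs of every order is size-obliviousness. *)
Inductive tester (R : Type) : Type :=
| Leaf of bool
| Sample of tester R
| Eqv of nat & nat & (bool -> tester R)
| Query of nat & nat & (bool -> tester R)
| Coin of R & (bool -> tester R).

Arguments Leaf {R}.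

Fixpoint valid_tester (R : realType) (T : tester R) : Prop :=
  match T with
  | Leaf _ => True
  | Sample k => valid_tester k
  | Eqv _ _ k => valid_tester (k true) /\ valid_tester (k false)
  | Query _ _ k => valid_tester (k true) /\ valid_tester (k false)
  | Coin p k => 0 <= p <= 1 /\ valid_tester (k true) /\ valid_tester (k false)
  end.

Definition eq_drawn (n : nat) (vs : seq 'I_n) (i j : nat) : bool :=
  match onth vs i, onth vs j with
  | Some u, Some v => u == v
  | _, _ => false
  end.

Definition query_drawn (n : nat) (G : adjmat n) (vs : seq 'I_n) (i j : nat)
    : bool :=
  match onth vs i, onth vs j with
  | Some u, Some v => (u, v) \in G
  | _, _ => false
  end.

Fixpoint acc_prob (R : realType) (n : nat) (G : adjmat n) (vs : seq 'I_n)
    (T : tester R) : R :=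
  match T with
  | Leaf a => if a then 1 else 0
  | Sample k => (n%:R)^-1 * \sum_(v : 'I_n) acc_prob G (rcons vs v) k
  | Eqv i j k => acc_prob G vs (k (eq_drawn vs i j))
  | Query i j k => acc_prob G vs (k (query_drawn G vs i j))
  | Coin p k => p * acc_prob G vs (k true) + (1 - p) * acc_prob G vs (k false)
  end.

Definition accept_prob (R : realType) (T : tester R) (n : nat) (G : adjmat n)
    : R := acc_prob G [::] T.

Definition is_so_POT (R : realType) (P : graph_property) (T : tester R)
    : Prop :=
  valid_tester T /\
  exists c : R, 0 < c <= 1 /\
  exists f : R -> R, (forall e : R, 0 < e <= 1 -> 0 < f e <= 1) /\
  forall (n : nat) (G : adjmat n), (0 < n)%N -> simple_graph G ->
    (P n G -> c <= accept_prob T G) /\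
    (forall e : R, 0 < e <= 1 -> eps_far P e G -> accept_prob T G <= c - f e).

Definition removal_property (R : realType) (h : nat) (w : adjmat h -> rat)
    (b : rat) : Prop :=
  exists f : R -> R, (forall e : R, 0 < e <= 1 -> 0 < f e <= 1) /\
  forall e : R, 0 < e < 1 ->
  forall (n : nat) (G : adjmat n), (0 < n)%N -> simple_graph G ->
    eps_far (Pi_hwb R w b) e G -> ratr b + f e <= weighted_sum R w G.

(* Main.v *)
(* Let G be eps-far from the property and suppose its weighted sum is below
   b + delta.  Pull G back along a uniformly random x : [m] -> V(G).  On average
   the weighted sum of the pullback does not exceed that of G, while weighted
   sums of m-vertex graphs that exceed b do so by at least 1/(D m^h), where D is
   a common denominator of b and the weights.  So if delta is much smaller than
   m^-h, then the pullback has the property with probability at least of order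
   m^-h.  On the other hand a size-oblivious tester, run on the pullback, averages
   over the coordinates of x a bounded function with mean at most c - f(eps); by
   McDiarmid's inequality the pullback is accepted with probability at least c
   only for a fraction exp(-kappa m) of the maps x.  For m large these two
   bounds contradict each other.  The choice of m depends only on eps; a large
   |V(G)| makes x almost surely injective, and for small |V(G)| the gap 1/(D n^h)
   applies to G itself. *)
Require Import Defs.
From mathcomp Require Import all_boot all_order all_algebra.
From mathcomp Require Import boolp reals sequences exp ring lra.
Import Order.TTheory GRing.Theory Num.Theory.
Local Open Scope ring_scope.
Set Implicit Arguments.
Unset Strict Implicit.
Unset Printing Implicit Defensive.

(** * Falling factorials against powers *)

Lemma ffact_leq_expn m s : (m ^_ s <= m ^ s)%N.
Proof.
elim: s => // s IH; rewrite ffactnSr expnSr.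
by apply: leq_mul => //; apply: leq_subr.
Qed.

(** Union bound on collisions: each of the at most [s ^ 2] pairs collides for a fraction [1 / m] of
    the maps. The extra factor [m] and the error on the right keep division and truncated
    subtraction out of the statement. *)
Lemma leq_expn_ffact m s : (m * m ^ s <= m * m ^_ s + s ^ 2 * m ^ s)%N.
Proof.
elim: s => [|s IH]; first by rewrite !expn0 ffactn0 leq_addr.
rewrite expnS ffactnSr.
have h1 : (m * m ^_ s <= m ^_ s * (m - s) + s * m ^ s)%N.
  have [sm|ms] := leqP s m.
    rewrite -{1}(subnK sm) mulnC mulnDr leq_add2l mulnC.
    by rewrite leq_mul2l ffact_leq_expn orbT.
  by rewrite ffact_small ?muln0.
apply: leq_trans (leq_mul (leqnn m) IH) _.
rewrite mulnDr (mulnCA m (s ^ 2)%N).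
apply: leq_trans (leq_add (leq_mul (leqnn m) h1) (leqnn _)) _.
rewrite !mulnDr -addnA leq_add2l (mulnCA m s) -mulnDl.
by rewrite leq_mul2r -!mulnn mulSn mulnS leq_addl orbT.
Qed.

(** * Uniform averages over finite types and over maps *)

Section Average.
Variable R : realType.

Definition avg (A : finType) (f : A -> R) : R := #|A|%:R^-1 * \sum_(a : A) f a.

Lemma eq_avg (A : finType) (f g : A -> R) : f =1 g -> avg f = avg g.
Proof. by move=> fg; rewrite /avg (eq_bigr g). Qed.

Lemma le_avg (A : finType) (f g : A -> R) :
  (forall a, f a <= g a) -> avg f <= avg g.
Proof.
by move=> fg; rewrite ler_wpM2l ?invr_ge0 ?ler0n//; exact: ler_sum.
Qed.

Lemma avg_cst (A : finType) (c : R) : (0 < #|A|)%N -> avg (fun _ : A => c) = c.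
Proof.
move=> A0; rewrite /avg sumr_const -[X in _ * X]mulr_natl mulrA mulVf ?mul1r//.
by rewrite pnatr_eq0 -lt0n.
Qed.

Lemma avgD (A : finType) (f g : A -> R) :
  avg (fun a => f a + g a) = avg f + avg g.
Proof. by rewrite /avg big_split mulrDr. Qed.

Lemma avgZ (A : finType) (c : R) (f : A -> R) :
  avg (fun a => c * f a) = c * avg f.
Proof. by rewrite /avg -mulr_sumr mulrCA. Qed.

Lemma avgB (A : finType) (f g : A -> R) :
  avg (fun a => f a - g a) = avg f - avg g.
Proof. by rewrite /avg big_split mulrDr sumrN mulrN. Qed.

Lemma avg_sum (A I : finType) (P : pred I) (f : I -> A -> R) :
  avg (fun a => \sum_(i | P i) f i a) = \sum_(i | P i) avg (f i).
Proof. by rewrite /avg exchange_big mulr_sumr. Qed.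

Lemma exchange_avg (A B : finType) (f : A -> B -> R) :
  avg (fun a => avg (f a)) = avg (fun b => avg (fun a => f a b)).
Proof.
by rewrite /avg -!mulr_sumr exchange_big /= mulrCA.
Qed.

Lemma avg_ge0 (A : finType) (f : A -> R) : (forall a, 0 <= f a) -> 0 <= avg f.
Proof. by move=> f0; rewrite mulr_ge0 ?invr_ge0 ?ler0n// sumr_ge0. Qed.

Definition fcons (V : finType) n (v : V) (x : {ffun 'I_n -> V}) :
    {ffun 'I_n.+1 -> V} :=
  [ffun i => if unlift ord0 i is Some j then x j else v].

Lemma fcons0 (V : finType) n (v : V) (x : {ffun 'I_n -> V}) :
  fcons v x ord0 = v.
Proof. by rewrite ffunE unlift_none. Qed.

Lemma fconsS (V : finType) n (v : V) (x : {ffun 'I_n -> V}) j :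
  fcons v x (lift ord0 j) = x j.
Proof. by rewrite ffunE liftK. Qed.

Lemma fcons_eta (V : finType) n (x : {ffun 'I_n.+1 -> V}) :
  fcons (x ord0) [ffun i => x (lift ord0 i)] = x.
Proof.
apply/ffunP => i; case: (unliftP ord0 i) => [j|] ->.
  by rewrite fconsS ffunE.
by rewrite fcons0.
Qed.

Lemma avg_ffunS (V : finType) n (F : {ffun 'I_n.+1 -> V} -> R) :
  avg F = avg (fun v => avg (fun x => F (fcons v x))).
Proof.
rewrite /avg -mulr_sumr !card_ffun !card_ord expnS natrM invfM mulrA.
congr (_ * _); rewrite pair_big /=.
rewrite (reindex (fun p : V * {ffun 'I_n -> V} => fcons p.1 p.2)) //=.
exists (fun x : {ffun 'I_n.+1 -> V} => (x ord0, [ffun i => x (lift ord0 i)])).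
  move=> [v x] _ /=; rewrite fcons0; congr pair.
  by apply/ffunP => i; rewrite ffunE fconsS.
by move=> x _; rewrite fcons_eta.
Qed.

Lemma avg_coord (V : finType) n (k : 'I_n) (f : V -> R) :
  avg (fun x : {ffun 'I_n -> V} => f (x k)) = avg f.
Proof.
elim: n k => [[]//|n IH] k; rewrite avg_ffunS.
case: (unliftP ord0 k) => [j|] ->.
  under eq_avg do (under eq_avg do rewrite fconsS).
  under eq_avg do rewrite IH.
  have [V0|V0] := posnP #|V|; last by rewrite avg_cst.
  by rewrite /avg V0 invr0 !mul0r.
under eq_avg do (under eq_avg do rewrite fcons0).
have [V0|V0] := posnP #|V|; first by rewrite /avg V0 invr0 !mul0r.
by under eq_avg do rewrite avg_cst ?card_ffun ?expn_gt0 ?V0//.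
Qed.

(** Overwriting the coordinates in the range of [s] with [y'] is injective on the fibre over [y],
    since overwriting again with [y] undoes it. By symmetry all fibres have equal size, so
    restriction to distinct coordinates preserves uniformity. *)
Lemma card_fiber_comp (V : finType) (I J : finType) (s : I -> J)
    (y y' : {ffun I -> V}) : injective s ->
  (#|[set x : {ffun J -> V} | [ffun k => x (s k)] == y]| <=
   #|[set x : {ffun J -> V} | [ffun k => x (s k)] == y']|)%N.
Proof.
move=> sI.
pose u (z : {ffun I -> V}) (x : {ffun J -> V}) :=
  [ffun j => if [pick k | s k == j] is Some k then z k else x j].
have uE z x : [ffun k => u z x (s k)] = z.
  apply/ffunP => k; rewrite !ffunE; case: pickP => [k' /eqP/sI->//|/(_ k)].
  by rewrite eqxx.
have uK z (x : {ffun J -> V}) : [ffun k => x (s k)] = z -> u z x = x.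
  move=> <-; apply/ffunP => j; rewrite ffunE; case: pickP => // k /eqP <-.
  by rewrite ffunE.
have uu z z' x : u z (u z' x) = u z x.
  by apply/ffunP => j; rewrite !ffunE; case: pickP.
rewrite -(@card_in_imset _ _ (u y')).
  apply/subset_leq_card/subsetP => _ /imsetP[x _ ->].
  by rewrite inE uE.
move=> x1 x2; rewrite !inE => /eqP/uK {2}<- /eqP/uK {2}<- E.
by rewrite -(uu y y' x1) E uu.
Qed.

Lemma avg_comp (V I J : finType) (s : I -> J) (g : {ffun I -> V} -> R) :
  (0 < #|V|)%N -> injective s ->
  avg (fun x : {ffun J -> V} => g [ffun k => x (s k)]) = avg g.
Proof.
move=> V0 sI.
pose N y := #|[set x : {ffun J -> V} | [ffun k => x (s k)] == y]|.
have [v _] : exists v : V, v \in V by apply/card_gt0P.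
pose y0 : {ffun I -> V} := [ffun=> v].
have NE y : N y = N y0 by apply/eqP; rewrite eqn_leq !card_fiber_comp.
have E (f : {ffun I -> V} -> R) :
    \sum_(x : {ffun J -> V}) f [ffun k => x (s k)] = (N y0)%:R * \sum_y f y.
  rewrite (partition_big (fun x : {ffun J -> V} => [ffun k => x (s k)])
    xpredT)//=.
  rewrite mulr_sumr; apply: eq_bigr => y _; rewrite -(NE y).
  rewrite (eq_bigr (fun=> f y)) => [|x /eqP->//].
  by rewrite sumr_const /N cardsE -[LHS]mulr_natl.
have c0 (K : finType) : #|{ffun K -> V}|%:R != 0 :> R.
  by rewrite pnatr_eq0 card_ffun expn_eq0 -leqn0 leqNgt V0.
have := E (fun=> 1); rewrite !sumr_const => cE.
rewrite /avg E mulrA; congr (_ * _).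
have N0 : (N y0)%:R != 0 :> R.
  by apply/eqP => N0; move: (c0 J); rewrite cE N0 mul0r eqxx.
by rewrite cE invfM mulrAC mulVf ?mul1r.
Qed.

Lemma avg_injective_ge (m s : nat) : (0 < m)%N ->
  1 - (s ^ 2)%:R / m%:R <=
    avg (fun i : {ffun 'I_s -> 'I_m} => (injectiveb i)%:R).
Proof.
move=> m0; rewrite /avg -natr_sum -big_mkcond sum1dep_card.
have := card_inj_ffuns 'I_s 'I_m; rewrite !card_ord => ->.
rewrite card_ffun !card_ord.
have ms0 : 0 < (m ^ s)%:R :> R by rewrite ltr0n expn_gt0 m0.
have mR0 : 0 < m%:R :> R by rewrite ltr0n.
have H : m%:R * (m ^ s)%:R <= m%:R * (m ^_ s)%:R + (s ^ 2)%:R * (m ^ s)%:R :> R.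
  by rewrite -!natrM -natrD ler_nat leq_expn_ffact.
rewrite -(ler_pM2r (mulr_gt0 mR0 ms0)).
have -> : (m ^ s)%:R^-1 * (m ^_ s)%:R * (m%:R * (m ^ s)%:R) =
    m%:R * (m ^_ s)%:R :> R.
  by field; rewrite gt_eqF.
have -> : (1 - (s ^ 2)%:R / m%:R) * (m%:R * (m ^ s)%:R) =
    m%:R * (m ^ s)%:R - (s ^ 2)%:R * (m ^ s)%:R :> R.
  by field; rewrite gt_eqF.
by rewrite lerBlDr.
Qed.

(** * Exponential moments *)

Lemma expR_quadratic_le (y : R) : `|y| <= 2^-1 -> expR y <= 1 + y + 2 * y ^+ 2.
Proof.
rewrite ler_norml => /andP[y1 y2].
have y3 : 0 < 1 - y by lra.
have h : expR y <= (1 - y)^-1.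
  rewrite -[y in expR y]opprK expRN lef_pV2 ?posrE ?expR_gt0//.
  exact: expR_ge1Dx.
apply: le_trans h _; rewrite -div1r ler_pdivrMr//.
have -> : (1 + y + 2 * y ^+ 2) * (1 - y) = 1 + y ^+ 2 * (1 - 2 * y) by ring.
by rewrite lerDl mulr_ge0 ?sqr_ge0//; lra.
Qed.

(** Deviations from the mean are at most [d], so the quadratic bound on [expR] applies; its linear
    term averages to zero. *)
Lemma avg_expR_le (V : finType) (X : V -> R) (l d : R) :
  (0 < #|V|)%N -> 0 <= l -> (forall v w, X v - X w <= d) -> l * d <= 2^-1 ->
  avg (fun v => expR (l * X v)) <= expR (l * avg X + 2 * (l * d) ^+ 2).
Proof.
move=> V0 l0 Xd ld; set mu := avg X.
have dev v : `|X v - mu| <= d.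
  rewrite ler_norml; apply/andP; split.
    rewrite lerBrDr -lerBrDl opprK -[X v + d](avg_cst _ V0).
    by apply: le_avg => w; have := Xd w v; lra.
  rewrite -[X v](avg_cst _ V0) -avgB -[d](avg_cst _ V0).
  by apply: le_avg => w.
have d0 : 0 <= d.
  have /card_gt0P[v _] := V0; exact: le_trans (dev v).
have E v : expR (l * X v) <=
    expR (l * mu) * (1 + 2 * (l * d) ^+ 2) + expR (l * mu) * l * (X v - mu).
  have -> : l * X v = l * mu + l * (X v - mu) by ring.
  have q : `|l * (X v - mu)| <= l * d.
    by rewrite normrM (ger0_norm l0) ler_wpM2l.
  have sq : (l * (X v - mu)) ^+ 2 <= (l * d) ^+ 2.
    by rewrite -[leLHS]real_normK ?num_real// lerXn2r ?nnegrE ?mulr_ge0.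
  rewrite expRD -mulrA -mulrDr ler_wpM2l ?expR_ge0//.
  by have := expR_quadratic_le (le_trans q ld); lra.
apply: le_trans (le_avg E) _.
rewrite avgD avg_cst// avgZ avgB avg_cst// subrr mulr0 addr0 expRD.
by rewrite ler_wpM2l ?expR_ge0// expR_ge1Dx.
Qed.

(* The exponential-moment form of McDiarmid's bounded differences inequality,
   with a non-optimal constant. *)
Lemma bounded_differences (V : finType) (l d : R) m
    (F : {ffun 'I_m -> V} -> R) :
  (0 < #|V|)%N -> 0 <= l -> l * d <= 2^-1 ->
  (forall (x y : {ffun 'I_m -> V}) j,
     (forall i, i != j -> x i = y i) -> F x - F y <= d) ->
  avg (fun x => expR (l * F x)) <=
    expR (l * avg F + m%:R * (2 * (l * d) ^+ 2)).
Proof.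
move=> V0 l0 ld.
elim: m F => [|m IH] F Fd.
  have /card_gt0P[v _] := V0.
  have F1 (g : {ffun 'I_0 -> V} -> R) : avg g = g [ffun=> v].
    rewrite -[RHS](@avg_cst {ffun 'I_0 -> V}) ?card_ffun ?expn_gt0 ?V0//.
    by apply: eq_avg => x; congr g; apply/ffunP => -[].
  by rewrite !F1 mul0r addr0.
rewrite avg_ffunS.
have ne (i : 'I_m) j : lift ord0 i != lift ord0 j -> i != j.
  by apply: contraNneq => ->.
(* Conditioning on the first coordinate [v]: the induction hypothesis handles the others, and the
   conditional mean, as a function of [v], still oscillates by at most [d]. *)
have H1 v : avg (fun x => expR (l * F (fcons v x))) <=
   expR (l * avg (fun x => F (fcons v x)) + m%:R * (2 * (l * d) ^+ 2)).
  apply: IH => x y j xy; apply: (Fd _ _ (lift ord0 j)) => i.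
  case: (unliftP ord0 i) => [k|] -> /=; last by rewrite !fcons0.
  by rewrite !fconsS => /ne/xy.
apply: le_trans (le_avg H1) _.
under eq_avg do rewrite expRD mulrC.
rewrite avgZ.
apply: le_trans (_ : expR (m%:R * (2 * (l * d) ^+ 2)) *
   expR (l * avg F + 2 * (l * d) ^+ 2) <= _).
  rewrite ler_wpM2l ?expR_ge0// avg_ffunS; apply: avg_expR_le => // v w.
  rewrite -avgB -[d](@avg_cst {ffun 'I_m -> V}) ?card_ffun ?expn_gt0 ?V0//.
  apply: le_avg => x; apply: (Fd _ _ ord0) => i.
  by case: (unliftP ord0 i) => [k|] ->; rewrite ?fconsS ?eqxx.
rewrite -expRD ler_expR -natr1 mulrDl mul1r; lra.
Qed.

End Average.

(** * Testers on pullbacks and their concentration *)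

Section Tester.
Variable R : realType.

Fixpoint samples (T : tester R) : nat :=
  match T with
  | Leaf _ => 0
  | Sample k => (samples k).+1
  | Eqv _ _ k | Query _ _ k | Coin _ k =>
      maxn (samples (k true)) (samples (k false))
  end.

(* The acceptance probability, over the coins only, when the vertices sampled
   after [vs] are read off the list [ys]. *)
Fixpoint run (n : nat) (G : adjmat n) (vs : seq 'I_n) (T : tester R)
    (ys : seq 'I_n) : R :=
  match T with
  | Leaf a => if a then 1 else 0
  | Sample k => if ys is y :: ys' then run G (rcons vs y) k ys' else 0
  | Eqv i j k => run G vs (k (eq_drawn vs i j)) ys
  | Query i j k => run G vs (k (query_drawn G vs i j)) ys
  | Coin p k => p * run G vs (k true) ys + (1 - p) * run G vs (k false) ys
  end.

Lemma run_bounds (n : nat) (G : adjmat n) vs T ys :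
  valid_tester T -> 0 <= run G vs T ys <= 1.
Proof.
elim: T vs ys => [a|k IH|i j k IH|i j k IH|p k IH] vs ys /=.
- by case: a; rewrite ?lexx ler01.
- by case: ys => [|y ys] vk; [rewrite lexx ler01|apply: IH].
- by case=> ? ?; apply: IH; case: (eq_drawn _ _ _).
- by case=> ? ?; apply: IH; case: (query_drawn _ _ _ _).
case=> /andP[p0 p1] [vt vf].
have /andP[a0 a1] := IH true vs ys vt; have /andP[b0 b1] := IH false vs ys vf.
by apply/andP; split; nra.
Qed.

(** Any [s] bounding the number of samples is allowed, so that both branches of a test can read the
    same list; surplus vertices are ignored. *)
Lemma acc_prob_avg (n s : nat) (G : adjmat n) vs T :
  (0 < n)%N -> (samples T <= s)%N ->
  acc_prob G vs T =
  avg (fun y : {ffun 'I_s -> 'I_n} => run G vs T [seq y i | i <- enum 'I_s]).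
Proof.
move=> n0.
have c0 t : (0 < #|{ffun 'I_t -> 'I_n}|)%N.
  by rewrite card_ffun expn_gt0 card_ord n0.
elim: T vs s => [a|k IH|i j k IH|i j k IH|p k IH] vs s /=.
- by rewrite avg_cst.
- case: s => // s /IH {}IH; rewrite avg_ffunS {1}/avg card_ord; congr (_ * _).
  apply: eq_bigr => v _; rewrite IH; apply: eq_avg => y.
  rewrite enum_ordSl /= fcons0 -map_comp; congr run.
  by apply: eq_map => i /=; rewrite fconsS.
- by rewrite geq_max => /andP[? ?]; apply: IH; case: (eq_drawn _ _ _).
- by rewrite geq_max => /andP[? ?]; apply: IH; case: (query_drawn _ _ _ _).
rewrite geq_max => /andP[st sf].
by rewrite (IH true vs s st) (IH false vs s sf) avgD !avgZ.
Qed.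

Definition pullback n m (G : adjmat n) (x : 'I_m -> 'I_n) : adjmat m :=
  [set p | (x p.1, x p.2) \in G].

Lemma pullback_simple n m (G : adjmat n) (x : 'I_m -> 'I_n) :
  simple_graph G -> simple_graph (pullback G x).
Proof.
move=> /andP[/forallP Gs /forallP Gi]; apply/andP; split.
  apply/forallP => u; apply/forallP => v; rewrite !inE.
  exact: (forallP (Gs _)).
by apply/forallP => u; rewrite inE.
Qed.

(** Adjacency answers agree for every [x]; injectivity is what makes the equality tests agree. *)
Lemma run_pullback n m (G : adjmat n) (x : 'I_m -> 'I_n) vs T ys :
  injective x -> run (pullback G x) vs T ys = run G (map x vs) T (map x ys).
Proof.
move=> xI; elim: T vs ys => [a|k IH|i j k IH|i j k IH|p k IH] vs ys //=.
- by case: ys => //= y ys; rewrite IH map_rcons.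
- rewrite IH /eq_drawn !onth_map; congr (run _ _ (k _) _).
  by case: onth => [u|]; case: onth => [v|] //=; rewrite (inj_eq xI).
- rewrite IH /query_drawn !onth_map; congr (run _ _ (k _) _).
  by case: onth => [u|]; case: onth => [v|] //=; rewrite inE.
by rewrite !IH.
Qed.

(** A V-statistic: indices are drawn with replacement, as the tester draws vertices of an [m]-vertex
    graph. *)
Definition emp_mean (V : finType) s m (g : {ffun 'I_s -> V} -> R)
    (x : {ffun 'I_m -> V}) : R :=
  avg (fun i : {ffun 'I_s -> 'I_m} => g [ffun k => x (i k)]).

(** Only index tuples hitting [j] matter, and each of the [s] positions hits it for a fraction
    [1 / m] of the tuples. *)
Lemma emp_mean_lipschitz (V : finType) s m (g : {ffun 'I_s -> V} -> R)
    (x y : {ffun 'I_m -> V}) j :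
  (forall z, 0 <= g z <= 1) -> (forall i, i != j -> x i = y i) ->
  emp_mean g x - emp_mean g y <= s%:R / m%:R.
Proof.
move=> g01 xy; rewrite -avgB.
apply: le_trans (_ : avg (fun i : {ffun 'I_s -> 'I_m} =>
    \sum_(k : 'I_s) (i k == j)%:R) <= _).
  apply: le_avg => i; have [/existsP[k ikj]|] := boolP [exists k, i k == j].
    rewrite (bigD1 k)//= ikj.
    have /andP[_ g1] := g01 [ffun k => x (i k)].
    have /andP[g0 _] := g01 [ffun k => y (i k)].
    apply: le_trans (_ : 1 <= _); first by lra.
    by rewrite lerDl sumr_ge0// => ? _; rewrite ler0n.
  move=> /existsPn ni.
  have -> : [ffun k => x (i k)] = [ffun k => y (i k)].
    by apply/ffunP => k; rewrite !ffunE xy.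
  by rewrite subrr sumr_ge0// => ? _; rewrite ler0n.
rewrite avg_sum (eq_bigr (fun=> m%:R^-1)).
  by rewrite sumr_const card_ord mulr_natl.
move=> k _; rewrite (avg_coord k (fun v => (v == j)%:R)) /avg card_ord.
by rewrite -natr_sum -big_mkcond sum1_card card1 mulr1.
Qed.

(** Along an injective index tuple the composed map is uniform, giving [avg g]; the remaining
    tuples, a fraction at most [s ^ 2 / m], contribute at most 1 each. *)
Lemma avg_emp_mean (V : finType) s m (g : {ffun 'I_s -> V} -> R) :
  (0 < m)%N -> (0 < #|V|)%N -> (forall z, 0 <= g z <= 1) ->
  avg (emp_mean (m := m) g) <= avg g + (s ^ 2)%:R / m%:R.
Proof.
move=> m0 V0 g01; rewrite exchange_avg.
have c0 t : (0 < #|{ffun 'I_t -> V}|)%N by rewrite card_ffun expn_gt0 V0.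
apply: le_trans (_ : avg (fun i : {ffun 'I_s -> 'I_m} =>
    avg g + (1 - (injectiveb i)%:R)) <= _).
  apply: le_avg => i; case: injectiveP => ii.
    by rewrite subrr addr0 (avg_comp g V0 ii).
  rewrite subr0; apply: ler_wpDl.
    by apply: avg_ge0 => z; case/andP: (g01 z).
  rewrite -[leRHS](avg_cst 1 (c0 m)); apply: le_avg => z.
  by case/andP: (g01 [ffun k => z (i k)]).
have ci : (0 < #|{ffun 'I_s -> 'I_m}|)%N.
  by rewrite card_ffun expn_gt0 card_ord m0.
rewrite avgD avgB !avg_cst// lerD2l.
by have := avg_injective_ge R s m0; lra.
Qed.

Lemma accept_prob_pullback n m s (G : adjmat n) (x : {ffun 'I_m -> 'I_n}) T :
  (0 < m)%N -> (samples T <= s)%N -> injective x ->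
  accept_prob T (pullback G x) =
  emp_mean (fun y : {ffun 'I_s -> 'I_n} =>
    run G [::] T [seq y i | i <- enum 'I_s]) x.
Proof.
move=> m0 sT xI; rewrite /accept_prob (acc_prob_avg _ _ m0 sT).
apply: eq_avg => i; rewrite run_pullback// -map_comp; congr run.
by apply: eq_map => k; rewrite /= ffunE.
Qed.

(** Half of the margin [a] absorbs the collision bias [s ^ 2 / m] of the empirical mean; the other
    half drives a Chernoff bound. *)
Lemma prob_accept_pullback n m s (G : adjmat n) T (c a : R) :
  (0 < n)%N -> (0 < s)%N -> (samples T <= s)%N -> valid_tester T ->
  0 < a <= 1 -> accept_prob T G <= c - a -> 2 * (s ^ 2)%:R <= a * m%:R ->
  avg (fun x : {ffun 'I_m -> 'I_n} =>
    (injectiveb x && (c <= accept_prob T (pullback G x)))%:R) <=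
  expR (- (a ^+ 2 / (32 * (s ^ 2)%:R) * m%:R)).
Proof.
move=> n0 s0 sT vT /andP[a0 a1] Ga ma.
have sR : 0 < s%:R :> R by rewrite ltr0n.
have m0 : (0 < m)%N.
  rewrite -(ltr0n R) -(pmulr_rgt0 _ a0); apply: lt_le_trans ma.
  by rewrite natrX; nra.
have mR : 0 < m%:R :> R by rewrite ltr0n.
pose g (y : {ffun 'I_s -> 'I_n}) : R := run G [::] T [seq y i | i <- enum 'I_s].
have g01 y : 0 <= g y <= 1 by exact: run_bounds.
have V0 : (0 < #|'I_n|)%N by rewrite card_ord.
(* The minimiser of [2 * l ^ 2 * s ^ 2 / m - l * a / 2]: the quadratic cost is then half of the
   linear gain. *)
pose l : R := a * m%:R / (8 * s%:R ^+ 2).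
have l0 : 0 <= l by rewrite /l divr_ge0 ?mulr_ge0 ?exprn_ge0// ltW.
have ldE : l * (s%:R / m%:R) = a / (8 * s%:R).
  by rewrite /l; field; rewrite !gt_eqF.
have s1 : 1 <= s%:R :> R by rewrite ler1n.
have ld : l * (s%:R / m%:R) <= 2^-1.
  by rewrite ldE ler_pdivrMr ?mulr_gt0//; nra.
have Fd (x y : {ffun 'I_m -> 'I_n}) j : (forall i, i != j -> x i = y i) ->
    emp_mean g x - emp_mean g y <= s%:R / m%:R.
  exact: emp_mean_lipschitz.
have H := bounded_differences V0 l0 ld Fd.
(* Exponential Markov inequality: the indicator of [c <= F] is at most [expR (l * (F - c))]. *)
apply: le_trans (_ :
    expR (- (l * c)) * avg (fun x => expR (l * emp_mean g x)) <= _).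
  rewrite -avgZ; apply: le_avg => x.
  case: injectiveP => xI /=; last by rewrite mulr_ge0 ?expR_ge0.
  rewrite (accept_prob_pullback _ m0 sT xI) -/g -expRD.
  case: (leP c) => cx /=; last exact: expR_ge0.
  apply: le_trans (expR_ge1Dx _); rewrite lerDl addrC -mulrN -mulrDr.
  by rewrite mulr_ge0// subr_ge0.
apply: le_trans (ler_wpM2l (expR_ge0 _) H) _.
rewrite -expRD ler_expR.
have := avg_emp_mean m0 V0 g01; rewrite -(acc_prob_avg _ _ n0 sT).
rewrite -/(accept_prob T G) => E.
have {}ma : (s ^ 2)%:R / m%:R <= a / 2.
  by rewrite ler_pdivrMr//; lra.
have {}E : avg (emp_mean (m := m) g) <= c - a / 2 by lra.
have E2 := ler_wpM2l l0 E.
have -> : m%:R * (2 * (l * (s%:R / m%:R)) ^+ 2) =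
    a ^+ 2 / (32 * (s ^ 2)%:R) * m%:R.
  by rewrite ldE natrX; field; rewrite gt_eqF.
have E3 : l * (c - a / 2) = l * c - 2 * (a ^+ 2 / (32 * (s ^ 2)%:R) * m%:R).
  by rewrite /l natrX; field; rewrite gt_eqF.
by rewrite E3 in E2; lra.
Qed.

End Tester.

(** * Densities, weighted sums and their averages over pullbacks *)

Section Density.
Variable R : realType.

Lemma common_denominator (I : finType) (q : I -> rat) :
  exists2 D : nat, (0 < D)%N & forall i, D%:R * ratr (q i) \is a @Num.int R.
Proof.
exists (\prod_i `|denq (q i)|)%N.
  by rewrite prodn_gt0// => i; rewrite absz_gt0 denq_neq0.
move=> i; rewrite (bigD1 i)//= natrM mulrAC rpredM ?rpred_nat//.
rewrite natr_absz ger0_norm ?denq_ge0// /ratr mulrCA mulfV ?mulr1 ?intr_int//.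
by rewrite intr_eq0 denq_neq0.
Qed.

Lemma dens_ge0 h n (H : adjmat h) (G : adjmat n) : 0 <= dens R H G.
Proof. by rewrite divr_ge0. Qed.

Lemma weighted_sum_ge0 h (w : adjmat h -> rat) n (G : adjmat n) :
  (forall H, simple_graph H -> 0 <= w H) -> 0 <= weighted_sum R w G.
Proof.
by move=> w0; apply: sumr_ge0 => H /w0 ?; rewrite mulr_ge0 ?dens_ge0// ler0q.
Qed.

(** Multiplying by [D] and the binomial clears all denominators, so the excess becomes a positive
    integer. *)
Lemma weighted_sum_gap h (w : adjmat h -> rat) (b : rat) D n (G : adjmat n) :
  (0 < n)%N -> (0 < D)%N -> D%:R * ratr b \is a @Num.int R ->
  (forall H, D%:R * ratr (w H) \is a @Num.int R) ->
  ratr b < weighted_sum R w G ->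
  ratr b + (D%:R * n%:R ^+ h)^-1 <= weighted_sum R w G.
Proof.
move=> n0 D0 Db Dw bG.
(* If [h] exceeds [n], the binomial is 0 and division by it makes every density 0, so 1 serves as
   denominator. *)
pose q := if 'C(n, h) is 0 then 1%N else 'C(n, h).
have q0 : (0 < q)%N by rewrite /q; case: 'C(n, h).
have qn : (q <= n ^ h)%N.
  rewrite /q; case E: 'C(n, h) => [|c]; first by rewrite expn_gt0 n0.
  rewrite -E; apply: leq_trans (ffact_leq_expn n h).
  by rewrite -bin_ffact leq_pmulr ?fact_gt0.
have qd (H : adjmat h) : q%:R * dens R H G \is a Num.int.
  rewrite /q /dens; case: 'C(n, h) => [|c]; first by rewrite invr0 !mulr0.
  by rewrite mulrCA mulfV ?pnatr_eq0// mulr1.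
have P0 : 0 < D%:R * q%:R :> R by rewrite mulr_gt0 ?ltr0n.
set d := weighted_sum R w G - ratr b.
have d0 : 0 < d by rewrite subr_gt0.
have Pd : D%:R * q%:R * d \is a Num.int.
  rewrite mulrBr rpredB//.
    rewrite mulr_sumr rpred_sum// => H _.
    by rewrite mulrACA rpredM.
  by rewrite mulrAC rpredM ?rpred_nat.
have : 1 <= D%:R * q%:R * d.
  have Pd0 : 0 < D%:R * q%:R * d by rewrite mulr_gt0.
  by rewrite -(gtr0_norm Pd0) norm_intr_ge1// gt_eqF.
rewrite -ler_pdivrMl// mulr1 => qd1.
rewrite -lerBrDl; apply: le_trans qd1.
rewrite lef_pV2 ?posrE ?mulr_gt0 ?exprn_gt0 ?ltr0n//.
by rewrite ler_wpM2l ?ler0n// -natrX ler_nat.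
Qed.

(** Each [h]-set is the image of [h!] injections. Injections, unlike sets, compose directly with a
    pullback map. *)
Lemma dens_ffun h n (H : adjmat h) (G : adjmat n) :
  dens R H G = (n ^_ h)%:R^-1 * \sum_(f : {ffun 'I_h -> 'I_n} | injectiveb f)
    (induced_iso H G (f @: [set: 'I_h]))%:R.
Proof.
have card_emb (S : {set 'I_n}) : #|S| == h ->
    #|[set f : {ffun 'I_h -> 'I_n} | injectiveb f & f @: [set: 'I_h] == S]| = h`!.
  move=> /eqP Sh; have := card_inj_ffuns_on 'I_h (mem S).
  rewrite card_ord Sh ffactnn => <-; apply: eq_card => f; rewrite !inE.
  rewrite andbC; case: injectiveP => [fI|]; last by rewrite !andbF.
  rewrite !andbT; apply/eqP/ffun_onP => [<- i|fS]; first exact: imset_f.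
  apply/eqP; rewrite eqEcard card_imset// cardsT card_ord Sh leqnn andbT.
  by apply/subsetP => _ /imsetP[i _ ->]; exact: fS.
have E : (\sum_(f : {ffun 'I_h -> 'I_n} | injectiveb f)
     induced_iso H G (f @: [set: 'I_h]) =
   #|[set S : {set 'I_n} | (#|S| == h) && induced_iso H G S]| * h`!)%N.
  rewrite (partition_big (fun f : {ffun 'I_h -> 'I_n} => f @: [set: 'I_h])
    (fun S : {set 'I_n} => #|S| == h)) /=; last first.
    by move=> f /injectiveP fI; rewrite card_imset// cardsT card_ord.
  rewrite (eq_bigr (fun S => h`! * induced_iso H G S))%N; last first.
    move=> S Sh; rewrite -(card_emb S Sh) -sum1dep_card big_distrl /=.
    by apply: eq_bigr => f /andP[_ /eqP->]; rewrite mul1n.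
  rewrite -big_distrr mulnC /=; congr (_ * _)%N.
  by rewrite -sum1dep_card big_mkcondr.
rewrite -natr_sum E /dens -bin_ffact !natrM invfM.
have h0 : h`!%:R != 0 :> R by rewrite pnatr_eq0 -lt0n fact_gt0.
by rewrite [X in _ = _ * X]mulrC mulrA mulfVK// mulrC.
Qed.

Lemma induced_iso_pullback h n m (H : adjmat h) (G : adjmat n)
    (x : 'I_m -> 'I_n) (S : {set 'I_m}) :
  injective x -> induced_iso H (pullback G x) S -> induced_iso H G (x @: S).
Proof.
move=> xI /existsP[f /and3P[/injectiveP fI /eqP fS /forallP fH]].
apply/existsP; exists [ffun i => x (f i)]; apply/and3P; split.
- by apply/injectiveP => i j; rewrite !ffunE => /xI/fI.
- rewrite -fS -imset_comp; apply/eqP/eq_imset => i; rewrite ffunE //.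
apply/forallP => i; apply/forallP => j; rewrite !ffunE.
by have /forallP/(_ j) := fH i; rewrite inE.
Qed.

(** For a fixed injection [f], the map [x \o f] is uniform over all maps, and these are injective
    for a fraction [n ^_ h / n ^ h <= 1]. This loss, and the discarded non-injective [x], turn
    equality into an inequality. *)
Lemma avg_dens_pullback h n m (H : adjmat h) (G : adjmat n) :
  (0 < n)%N -> (h <= n)%N ->
  avg (fun x : {ffun 'I_m -> 'I_n} =>
    (injectiveb x)%:R * dens R H (pullback G x)) <= dens R H G.
Proof.
move=> n0 hn.
pose t (y : {ffun 'I_h -> 'I_n}) : R :=
  (injectiveb y && induced_iso H G (y @: [set: 'I_h]))%:R.
have tG : avg t <= dens R H G.
  rewrite /avg dens_ffun card_ffun !card_ord.
  have -> : \sum_a t a = \sum_(f : {ffun 'I_h -> 'I_n} | injectiveb f)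
    (induced_iso H G (f @: [set: 'I_h]))%:R.
    rewrite [RHS]big_mkcond; apply: eq_bigr => f _.
    by rewrite /t; case: injectiveb.
  rewrite ler_wpM2r ?sumr_ge0// lef_pV2 ?posrE ?ltr0n ?expn_gt0 ?n0//.
    by rewrite ler_nat ffact_leq_expn.
  by rewrite ffact_gt0.
have V0 : (0 < #|'I_n|)%N by rewrite card_ord.
apply: le_trans (_ : avg (fun x : {ffun 'I_m -> 'I_n} => (m ^_ h)%:R^-1 *
   \sum_(f : {ffun 'I_h -> 'I_m} | injectiveb f) t [ffun k => x (f k)]) <= _).
  apply: le_avg => x; case: injectiveP => xI; last first.
    by rewrite mul0r mulr_ge0 ?invr_ge0// sumr_ge0.
  rewrite mul1r dens_ffun ler_wpM2l ?invr_ge0//.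
  apply: ler_sum => f /injectiveP fI; rewrite /t ler_nat.
  have -> : injectiveb [ffun k => x (f k)].
    by apply/injectiveP => i j; rewrite !ffunE => /xI/fI.
  case: (boolP (induced_iso H (pullback G x) _)) => //=.
  move=> /(induced_iso_pullback xI).
  rewrite -imset_comp.
  rewrite (_ : (x \o f) @: _ = [ffun k => x (f k)] @: [set: 'I_h]) => [->//|].
  by apply: eq_imset => i; rewrite ffunE.
rewrite avgZ avg_sum (eq_bigr (fun=> avg t)) => [|f /injectiveP fI]; last first.
  exact: avg_comp.
have := card_inj_ffuns 'I_h 'I_m; rewrite !card_ord cardsE => cE.
rewrite sumr_const cE -[X in _ * X]mulr_natl mulrA.
have [->|/eqP m0] := eqVneq (m ^_ h) 0%N.
  by rewrite invr0 !mul0r dens_ge0.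
by rewrite mulVf ?mul1r// pnatr_eq0; apply/eqP.
Qed.

Lemma avg_weighted_sum_pullback h (w : adjmat h -> rat) n m (G : adjmat n) :
  (forall H, simple_graph H -> 0 <= w H) -> (0 < n)%N -> (h <= n)%N ->
  avg (fun x : {ffun 'I_m -> 'I_n} =>
    (injectiveb x)%:R * weighted_sum R w (pullback G x)) <= weighted_sum R w G.
Proof.
move=> w0 n0 hn; under eq_avg do rewrite mulr_sumr.
rewrite avg_sum; apply: ler_sum => H sH.
under eq_avg do rewrite mulrCA.
by rewrite avgZ ler_wpM2l ?ler0q ?w0// avg_dens_pullback.
Qed.

(** The degree [h + 1] term of the exponential series suffices once [m] reaches
    [C * (h + 1)! / k ^ (h + 1)]. *)
Lemma exp_beats_poly (k C : R) (h N : nat) : 0 < k -> 0 < C ->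
  exists2 m : nat, (N <= m)%N & C * m%:R ^+ h <= expR (k * m%:R).
Proof.
move=> k0 C0.
pose M := Num.bound (C * (h.+1)`!%:R / k ^+ h.+1).
exists (N + M)%N; first exact: leq_addr.
set m := (N + M)%:R : R.
have m0 : 0 <= m by rewrite /m.
have fk : 0 < (h.+1)`!%:R :> R by rewrite ltr0n fact_gt0.
have Mm : C * (h.+1)`!%:R / k ^+ h.+1 <= m.
  apply: ltW; apply: lt_le_trans (_ : M%:R <= _).
    by rewrite archi_boundP// divr_ge0 ?exprn_ge0 ?mulr_ge0// ltW.
  by rewrite /m ler_nat leq_addl.
apply: le_trans (_ : (k * m) ^+ h.+1 / (h.+1)`!%:R <= _); last first.
  by have := @expR_ge1Dxn R (k * m) h (mulr_ge0 (ltW k0) m0); lra.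
rewrite ler_pdivlMr// exprMn [m ^+ h.+1]exprS [leRHS]mulrA [leLHS]mulrAC.
rewrite ler_wpM2r ?exprn_ge0//.
by move: Mm; rewrite ler_pdivrMr ?exprn_gt0// [m * _]mulrC.
Qed.

End Density.

(** * Choice of the parameters and the contradiction *)

Theorem theorem1p6 (R : realType) (h : nat) (w : adjmat h -> rat) (b : rat) :
  (2 <= h)%N ->
  (forall H : adjmat h, simple_graph H -> 0 <= w H) ->
  (exists T : tester R, is_so_POT (Pi_hwb R w b) T) ->
  removal_property R w b.
Proof.
move=> _ w0 [T [vT [c [_ [f [f01 Tf]]]]]].
(* Choice needs a value at every real [e]; outside [(0, 1)], where nothing is asked of graphs, it is
   1. *)
suff key (e : R) : exists2 a : R, 0 < a <= 1 &
    (0 < e < 1 -> forall (n : nat) (G : adjmat n),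
     (0 < n)%N -> simple_graph G ->
     eps_far (Pi_hwb R w b) e G -> ratr b + a <= weighted_sum R w G).
  have [g gP] := choice (fun e => let: ex_intro2 a p q := key e in
     ex_intro _ a (conj p q)).
  by exists g; split=> e e01; have [] := gP e; [|move=> _; exact].
have [e01|ne] := boolP (0 < e < 1); last first.
  by exists 1; rewrite ?ltr01 ?lexx// => e01; rewrite e01 in ne.
(* For negative [b] no graph has the property, and nonnegativity of weighted sums gives the gap
   [- b]. *)
have [b0|b0] := ltP b 0.
  exists (Num.min 1 (- ratr b)).
    by rewrite lt_min ltr01 oppr_gt0 ltrq0 b0 ge_min lexx.
  move=> _ n G _ _ _; apply: le_trans (weighted_sum_ge0 R G w0).
  by rewrite -lerBrDl sub0r ge_min lexx orbT.
have {}b0 : 0 <= ratr b :> R by rewrite ler0q.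
have /andP[e0 e1] := e01.
have fe : 0 < f e <= 1 by apply: f01; rewrite e0 ltW.
have /andP[fe0 fe1] := fe.
(* The option type puts [b] beside the weights, so that one [D] clears them all. *)
have [D D0 Dq] := common_denominator R
  (fun o : option (adjmat h) => if o is Some H then w H else b).
have Db := Dq None; have Dw H := Dq (Some H).
have D1 : 1 <= D%:R :> R by rewrite ler1n.
pose s := (samples T).+1.
have sR : 0 < (s ^ 2)%:R :> R by rewrite ltr0n.
pose k : R := f e ^+ 2 / (32 * (s ^ 2)%:R).
have k0 : 0 < k by rewrite /k divr_gt0 ?mulr_gt0 ?exprn_gt0.
(* Chosen so that [(b + 1) / (C * m ^ h)] equals [gam / 4], where [gam = 1 / (D * m ^ h)] is the gap
   at order [m]. *)
pose C : R := 4 * D%:R * (ratr b + 1).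
have C0 : 0 < C by rewrite /C; nra.
pose N := Num.bound (2 * (s ^ 2)%:R / f e).
have [m Nm mC] := exp_beats_poly h N.+1 k0 C0.
have m0 : (0 < m)%N by apply: leq_trans Nm.
have mN : 2 * (s ^ 2)%:R <= f e * m%:R.
  rewrite [f e * _]mulrC -ler_pdivrMr//; apply: le_trans (_ : N%:R <= _).
    by rewrite ltW// archi_boundP// divr_ge0 ?mulr_ge0// ltW.
  by rewrite ler_nat ltnW.
have mh0 : 1 <= m%:R ^+ h :> R by rewrite exprn_ege1// ler1n.
pose M := Num.bound (C * m%:R ^+ h * (m ^ 2)%:R).
(* For [n >= n0], [M] makes the collision term [m ^ 2 / n] small and [h] ensures [h <= n]; [m] keeps
   the gap at order [n0] below [gam]. *)
pose n0 := (M + m + h)%N.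
have mn0 : m%:R <= n0%:R :> R by rewrite ler_nat /n0 -addnA addnCA leq_addr.
have n01 : 1 <= n0%:R ^+ h :> R.
  by rewrite exprn_ege1//; apply: le_trans mn0; rewrite ler1n.
have mnh : m%:R ^+ h <= n0%:R ^+ h :> R by rewrite lerXn2r ?nnegrE.
(* Half the gap at order [n0]: it is below the gap of every order up to [n0], and at most
   [gam / 2]. *)
exists (2 * D%:R * n0%:R ^+ h)^-1.
  have H : 1 <= 2 * D%:R * n0%:R ^+ h :> R by nra.
  by rewrite invr_gt0 invf_le1 ?H ?andbT//; lra.
move=> _ n G npos sG far.
have bG : ratr b < weighted_sum R w G.
  rewrite ltNge; apply/negP => Gb; have := far G sG Gb.
  by rewrite /mat_dist setDv setU0 cards0 leNgt mulr_gt0// exprn_gt0// ltr0n.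
have mh_pos : 0 < m%:R ^+ h :> R by apply: lt_le_trans mh0.
have nh_pos : 0 < n0%:R ^+ h :> R by apply: lt_le_trans n01.
have Dpos : 0 < D%:R :> R by apply: lt_le_trans D1.
have [nn0|/ltnW nn0] := leqP n n0.
  apply: le_trans (weighted_sum_gap npos D0 Db Dw bG).
  rewrite lerD2l lef_pV2 ?posrE ?mulr_gt0 ?exprn_gt0 ?ltr0n//.
  have nh : n%:R ^+ h <= n0%:R ^+ h :> R by rewrite lerXn2r ?nnegrE ?ler_nat.
  have := ler_wpM2l (ltW Dpos) nh; have := mulr_gt0 Dpos nh_pos; lra.
rewrite leNgt; apply/negP => small.
pose gam : R := (D%:R * m%:R ^+ h)^-1.
have gam0 : 0 < gam by rewrite invr_gt0 mulr_gt0.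
have gam1 : gam <= 1.
  by rewrite invf_le1 ?mulr_gt0//; nra.
have {}small : weighted_sum R w G < ratr b + gam / 2.
  apply: lt_le_trans small _; rewrite lerD2l -invfM lef_pV2 ?posrE ?mulr_gt0//.
  by rewrite mulrC mulrA ler_wpM2l// mulr_ge0// ltW.
pose p : R := avg (fun x : {ffun 'I_m -> 'I_n} =>
   (injectiveb x && (c <= accept_prob T (pullback G x)))%:R).
have pE : p <= expR (- (k * m%:R)).
  apply: prob_accept_pullback => //.
  by have [_ /(_ e)] := Tf n G npos sG; apply; rewrite ?e0 ?ltW.
pose q : R := avg (fun x : {ffun 'I_m -> 'I_n} => (injectiveb x)%:R).
have qE : 1 - (m ^ 2)%:R / n%:R <= q by apply: avg_injective_ge.
have hn : (h <= n)%N by apply: leq_trans nn0; exact: leq_addl.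
(* Size-obliviousness enters here: the same [T] and [c] serve at order [m]. For injective [x], a
   pullback with the property is accepted with probability at least [c], so the left term vanishes;
   otherwise the gap at order [m] applies. *)
have main : (ratr b + gam) * (q - p) <= weighted_sum R w G.
  apply: le_trans (@avg_weighted_sum_pullback R h w n m G w0 npos hn).
  rewrite -avgB -avgZ; apply: le_avg => x.
  have ws0 := weighted_sum_ge0 R (pullback G x) w0.
  have sx := pullback_simple x sG.
  case: injectiveP => xI /=; last by rewrite subrr mulr0 mul0r.
  rewrite mul1r.
  have [xb|bx] := lerP (weighted_sum R w (pullback G x)) (ratr b).
    have [/(_ xb) -> _] := Tf m _ m0 sx.
    by rewrite subrr mulr0.
  apply: le_trans (weighted_sum_gap m0 D0 Db Dw bx).
  by rewrite ler_piMr ?addr_ge0 ?(ltW gam0)// lerBlDr lerDl.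
have CE : (ratr b + 1) / C = 4^-1 / D%:R.
  by rewrite /C; field; rewrite !gt_eqF//; lra.
have small1 : (ratr b + 1) * p <= gam / 4.
  have p1 : p <= (C * m%:R ^+ h)^-1.
    apply: le_trans pE _; rewrite expRN.
    by rewrite lef_pV2 ?posrE ?expR_gt0 ?(mulr_gt0 C0 mh_pos).
  apply: le_trans (ler_wpM2l _ p1) _; first by lra.
  by rewrite invfM mulrA CE /gam invfM; lra.
have small2 : (ratr b + 1) * ((m ^ 2)%:R / n%:R) <= gam / 4.
  have p1 : (m ^ 2)%:R / n%:R <= (C * m%:R ^+ h)^-1.
    rewrite ler_pdivrMr ?ltr0n// ler_pdivlMl ?(mulr_gt0 C0 mh_pos)//.
    apply: le_trans (_ : M%:R <= _).
      by apply/ltW/archi_boundP; rewrite mulr_ge0 ?(ltW (mulr_gt0 C0 mh_pos)).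
    by rewrite ler_nat; apply: leq_trans nn0; rewrite /n0 -addnA leq_addr.
  apply: le_trans (ler_wpM2l _ p1) _; first by lra.
  by rewrite invfM mulrA CE /gam invfM; lra.
have p0 : 0 <= p by apply: avg_ge0.
have n2 : 0 <= (m ^ 2)%:R / n%:R :> R by rewrite divr_ge0.
set z := _ / _ in qE small2 n2.
(* The left side is at least [b + gam - (b + 1) * (z + p)], hence at least [b + gam / 2] by the two
   quarter bounds, contradicting [small]. *)
have h1 : (ratr b + gam) * (1 - z - p) <= (ratr b + gam) * (q - p).
  by rewrite ler_wpM2l ?addr_ge0 ?(ltW gam0)// lerD2r.
have h2 : (ratr b + gam) * (z + p) <= (ratr b + 1) * (z + p).
  by rewrite ler_wpM2r ?addr_ge0// lerD2l.
lra.
Qed.
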